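(* Let $n\ge 1$, $A\in\mathbb{R}^{n\times n}$ and $b\in\mathbb{R}^n$. For $x\in\mathbb{R}^n$ put $Q(x)=Ax+x-b$, $F(x)=Ax-x-b$ and $$r(x)=Q(x)-P_{\mathcal{K}^n}\left[Q(x)-F(x)\right],$$ where $P_{\mathcal{K}^n}$ is the Euclidean projection onto the second-order cone $\mathcal{K}^n$. Then $x^*\in\mathbb{R}^n$ solves the absolute value equations associated with the second-order cone $Ax-|x|-b=0$ if and only if $r(x^* )=0$. Furthermore, for all $x\in\mathbb{R}^n$, $$r(x)=Ax-|x|-b.$$
   Context: The second-order cone is $\mathcal{K}^n=\{(x_1,x_2)\in\mathbb{R}\times\mathbb{R}^{n-1}:\|x_2\|\le x_1\}$, with $\|\cdot\|$ the Euclidean norm; for $n=1$, $\mathcal{K}^1=\mathbb{R}_+$. The projection is $P_{\mathcal{K}^n}(x)=\arg\min\{\|x-y\|:y\in\mathcal{K}^n\}$. The vector $|x|$ is not the componentwise absolute value. It is $|x|=\sqrt{x\circ x}$ with respect to the Jordan product $x\circ y=(\langle x,y\rangle,\,y_1x_2+x_1y_2)$, where the square root is the one in $\mathcal{K}^n$ defined through the spectral decomposition. Explicitly, for $x=(x_1,x_2)\in\mathbb{R}\times\mathbb{R}^{n-1}$: $$|x|=\tfrac12\Big(\big|x_1-\|x_2\|\big|+\big|x_1+\|x_2\|\big|,\ \big(\big|x_1+\|x_2\|\big|-\big|x_1-\|x_2\|\big|\big)\tfrac{x_2}{\|x_2\|}\Big)\ \text{ if } x_2\ne 0,$$ and $|x|=(|x_1|,0)$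 if $x_2=0$ (for $n=1$ this is the usual absolute value). *)

(* Defs.v *)
From HB Require Import structures.
From mathcomp Require Import all_boot all_order all_algebra.
From mathcomp Require Import ring lra.
From mathcomp Require Import boolp classical_sets reals.

Set Implicit Arguments.
Unset Strict Implicit.
Unset Printing Implicit Defensive.

Import Order.TTheory GRing.Theory Num.Theory.
Local Open Scope classical_set_scope.
Local Open Scope ring_scope.

Section Euclidean.
Context {R : realType} {n : nat}.
Implicit Types (x y : 'cV[R]_n) (K : set 'cV[R]_n).

Definition dotv x y : R := \sum_i x i 0 * y i 0.

(* Not the norm `|x| of MathComp-Analysis, which is the sup norm. *)
Definition enorm x : R := Num.sqrt (dotv x x).

Definition argmin_dist K x : set 'cV[R]_n :=
  [set p | K p /\ forall y, K y -> enorm (x - p) <= enorm (x - y)].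

(* A point of the argmin set. The default value 0 is only used when the set is
   empty, which does not happen for a nonempty closed K; the point is unique
   when K is moreover convex. *)
Definition proj K x : 'cV[R]_n := xget 0 (argmin_dist K x).

End Euclidean.

(* R^n with n >= 1 is 'cV[R]_(1 + m), so that m = n - 1 and a vector splits as
   x = (x_1, x_2) in R * R^m. *)
Section SecondOrderCone.
Context {R : realType} {m : nat}.
Implicit Types x y : 'cV[R]_(1 + m).

Definition hd x : R := x 0 0.
Definition tl x : 'cV[R]_m := dsubmx x.
Definition vec (a : R) (v : 'cV[R]_m) : 'cV[R]_(1 + m) := col_mx a%:M v.

Definition soc : set 'cV[R]_(1 + m) := [set x | enorm (tl x) <= hd x].

Definition jordan x y : 'cV[R]_(1 + m) :=
  vec (dotv x y) (hd y *: tl x + hd x *: tl y).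

(* Spectral decomposition x = lam1 x *: u1 x + lam2 x *: u2 x. When tl x = 0
   one usually replaces tl x / enorm (tl x) by an arbitrary unit vector of R^m;
   here it is 0 since 0^-1 = 0. As lam1 x = lam2 x in that case, soc_sqrt does
   not depend on that choice, and m = 0, where there is no unit vector, is
   covered. *)
Definition lam1 x : R := hd x - enorm (tl x).
Definition lam2 x : R := hd x + enorm (tl x).
Definition u1 x : 'cV[R]_(1 + m) :=
  2^-1 *: vec 1 (- ((enorm (tl x))^-1 *: tl x)).
Definition u2 x : 'cV[R]_(1 + m) :=
  2^-1 *: vec 1 ((enorm (tl x))^-1 *: tl x).

Definition soc_sqrt x : 'cV[R]_(1 + m) :=
  Num.sqrt (lam1 x) *: u1 x + Num.sqrt (lam2 x) *: u2 x.

Definition soc_abs x : 'cV[R]_(1 + m) := soc_sqrt (jordan x x).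

Lemma hd_vec a v : hd (vec a v) = a.
Proof.
rewrite /hd /vec -(lshift0 m 0).
by rewrite (@col_mxEu _ 1 m 1) mxE eqxx mulr1n.
Qed.

Lemma tl_vec a v : tl (vec a v) = v.
Proof. exact: col_mxKd. Qed.

Lemma vecP x y : hd x = hd y -> tl x = tl y -> x = y.
Proof.
move=> h t; rewrite -[x]vsubmxK -[y]vsubmxK; congr col_mx => //.
apply/matrixP => i j; rewrite !ord1 !mxE.
have -> : lshift m (0 : 'I_1) = 0 by exact: val_inj.
exact: h.
Qed.

Lemma dotv_vec x : dotv x x = hd x ^+ 2 + enorm (tl x) ^+ 2.
Proof.
have ge0 : 0 <= dotv (tl x) (tl x).
  by apply: sumr_ge0 => i _; rewrite -expr2 sqr_ge0.
rewrite /enorm sqr_sqrtr // /dotv big_ord_recl expr2; congr (_ + _).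
by apply: eq_bigr => i _; rewrite !mxE -!rshift1.
Qed.

Lemma enormZ k (a : R) (v : 'cV[R]_k) : enorm (a *: v) = `|a| * enorm v.
Proof.
rewrite /enorm -sqrtr_sqr -sqrtrM ?sqr_ge0 //; congr Num.sqrt.
by rewrite /dotv mulr_sumr; apply: eq_bigr => i _; rewrite !mxE; ring.
Qed.

Lemma enorm_eq0 k (v : 'cV[R]_k) : enorm v = 0 -> v = 0.
Proof.
move=> /eqP; rewrite sqrtr_eq0 => le0; apply/matrixP => i j; rewrite ord1 mxE.
have ge0 l : true -> 0 <= v l 0 * v l 0 by rewrite -expr2 sqr_ge0.
have : dotv v v == 0 by rewrite eq_le le0 sumr_ge0.
rewrite psumr_eq0 // => /allP/(_ i (mem_index_enum _))/=.
by rewrite mulf_eq0 orbb => /eqP.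
Qed.

(* The usual closed form of soc_abs. *)
Lemma soc_absE x : let nx2 := enorm (tl x) in
  soc_abs x =
  if tl x != 0 then
    2^-1 *: vec (`|hd x - nx2| + `|hd x + nx2|)
                ((`|hd x + nx2| - `|hd x - nx2|) *: (nx2^-1 *: tl x))
  else vec `|hd x| 0.
Proof.
have hdZ c y : hd (c *: y) = c * hd y by rewrite /hd mxE.
have tlZ c y : tl (c *: y) = c *: tl y by rewrite /tl linearZ.
have hdD y z : hd (y + z) = hd y + hd z by rewrite /hd mxE.
have tlD y z : tl (y + z) = tl y + tl z by rewrite /tl linearD.
move=> nx2; set a := hd x.
have n0 : 0 <= nx2 by exact: sqrtr_ge0.
have dE : dotv x x = `|a| ^+ 2 + nx2 ^+ 2.
  by rewrite dotv_vec real_normK ?num_real.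
have eE : enorm (tl (jordan x x)) = 2 * `|a| * nx2.
  rewrite /jordan tl_vec -scalerDl enormZ -mulr2n normrMn -/a -/nx2.
  by rewrite mulr_natl.
have l1 : Num.sqrt (lam1 (jordan x x)) = `| `|a| - nx2|.
  by rewrite /lam1 eE /jordan hd_vec dE -[RHS]sqrtr_sqr; congr Num.sqrt; ring.
have l2 : Num.sqrt (lam2 (jordan x x)) = `|a| + nx2.
  rewrite /lam2 eE /jordan hd_vec dE.
  by rewrite -[RHS]ger0_norm ?addr_ge0 // -[RHS]sqrtr_sqr; congr Num.sqrt; ring.
rewrite /soc_abs /soc_sqrt l1 l2 /u1 /u2 eE {l1 l2 eE dE}.
have -> : tl (jordan x x) = (2 * a) *: tl x.
  by rewrite /jordan tl_vec -scalerDl mulrDl mul1r.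
apply: vecP; rewrite !(hdD, tlD, hdZ, tlZ).
  case: eqVneq => [t0|_]; rewrite /= ?hdZ !hd_vec.
    have -> : nx2 = 0.
      by rewrite /nx2 t0 /enorm /dotv big1 ?sqrtr0 // => i _; rewrite mxE mul0r.
    by rewrite subr0 normr_id; field.
  case: (ltP a 0) => a0.
    rewrite [`|a - _|]ler0_norm; last by lra.
    rewrite (ltr0_norm a0) -[`|- a - _|]normrN opprB opprK [nx2 + a]addrC.
    by field.
  rewrite (ger0_norm (addr_ge0 a0 n0)) (ger0_norm a0).
  by field.
case: eqVneq => [t0|t0]; rewrite /= ?tlZ !tl_vec.
  by rewrite t0 !(scaler0, oppr0, addr0).
have {t0}np : 0 < nx2.
  by rewrite lt_def n0 andbT; apply: contra t0 => /eqP/enorm_eq0 ->.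
rewrite -!scaleNr !scalerA -!scalerDl; congr (_ *: _).
case: (ltgtP a 0) => [an|ap|->].
- rewrite [`|a - _|]ltr0_norm; last by lra.
  rewrite (ltr0_norm an) -[`|- a - _|]normrN opprB opprK [nx2 + a]addrC.
  by field; rewrite gt_eqF // lt_eqF.
- rewrite (gtr0_norm ap) (ger0_norm (addr_ge0 (ltW ap) n0)).
  by field; rewrite !gt_eqF.
- by rewrite sub0r add0r !normrN !mulr0 subrr mulr0 mul0r addr0.
Qed.

End SecondOrderCone.

Section AbsoluteValueEquation.
Context {R : realType} {m : nat}.
Implicit Types (A : 'M[R]_(1 + m)) (b x : 'cV[R]_(1 + m)).

Definition Qmap A b x : 'cV[R]_(1 + m) := A *m x + x - b.
Definition Fmap A b x : 'cV[R]_(1 + m) := A *m x - x - b.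
Definition residual A b x : 'cV[R]_(1 + m) :=
  Qmap A b x - proj soc (Qmap A b x - Fmap A b x).

End AbsoluteValueEquation.

(* Main.v *)
(** With [p := x + |x|], both [p] and [p - 2 x = |x| - x] lie in the cone and
    are orthogonal. As the cone is self-dual, [<2 x - p, y - p> <= 0] for every
    [y] in it, so [p] is the projection of [2 x = Q x - F x] by the variational
    characterization of projections, and [r x = Q x - x - |x|]. *)
Require Import Defs.
From HB Require Import structures.
From mathcomp Require Import all_boot all_order all_algebra.
From mathcomp Require Import ring lra.
From mathcomp Require Import boolp classical_sets reals.

Set Implicit Arguments.
Unset Strict Implicit.
Unset Printing Implicit Defensive.

Import Order.TTheory GRing.Theory Num.Theory.
Local Open Scope classical_set_scope.
Local Open Scope ring_scope.

Section Euclidean.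
Context {R : realType} {n : nat}.
Implicit Types (x y z p : 'cV[R]_n) (K : set 'cV[R]_n).

Lemma dotvC x y : dotv x y = dotv y x.
Proof. by apply: eq_bigr => i _; rewrite mulrC. Qed.

Lemma dotvDl x y z : dotv (x + y) z = dotv x z + dotv y z.
Proof. by rewrite -big_split; apply: eq_bigr => i _; rewrite mxE mulrDl. Qed.

Lemma dotvZl (a : R) x y : dotv (a *: x) y = a * dotv x y.
Proof. by rewrite mulr_sumr; apply: eq_bigr => i _; rewrite mxE mulrA. Qed.

Lemma dotvNl x y : dotv (- x) y = - dotv x y.
Proof. by rewrite -scaleN1r dotvZl mulN1r. Qed.

Lemma dotvDr x y z : dotv z (x + y) = dotv z x + dotv z y.
Proof. by rewrite dotvC dotvDl !(dotvC z). Qed.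

Lemma dotvZr (a : R) x y : dotv x (a *: y) = a * dotv x y.
Proof. by rewrite dotvC dotvZl dotvC. Qed.

Lemma dotvNr x y : dotv x (- y) = - dotv x y.
Proof. by rewrite dotvC dotvNl dotvC. Qed.

Definition dotvE := (dotvDl, dotvDr, dotvNl, dotvNr, dotvZl, dotvZr).

Lemma dotv_ge0 x : 0 <= dotv x x.
Proof. by apply: sumr_ge0 => i _; rewrite -expr2 sqr_ge0. Qed.

Lemma enorm_ge0 x : 0 <= enorm x.
Proof. exact: sqrtr_ge0. Qed.

Lemma sqr_enorm x : enorm x ^+ 2 = dotv x x.
Proof. by rewrite sqr_sqrtr ?dotv_ge0. Qed.

Lemma enorm0 : enorm (0 : 'cV[R]_n) = 0.
Proof. by rewrite -(scale0r 0) enormZ normr0 mul0r. Qed.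

(** The lower half of Cauchy-Schwarz. For nonzero vectors, the squared norm of
    [enorm y *: x + enorm x *: y] is nonnegative and equals [2 * (enorm x * enorm y) * (enorm x *
    enorm y + dotv x y)]. *)
Lemma dotv_ge_opp x y : - (enorm x * enorm y) <= dotv x y.
Proof.
have [/enorm_eq0 ->|x0] := eqVneq (enorm x) 0.
  by rewrite enorm0 mul0r -(scale0r 0) dotvZl mul0r oppr0.
have [/enorm_eq0 ->|y0] := eqVneq (enorm y) 0.
  by rewrite enorm0 mulr0 -(scale0r 0) dotvZr mul0r oppr0.
have xy0 : 0 < enorm x * enorm y by rewrite mulr_gt0 // lt_def enorm_ge0 ?x0 ?y0.
have := dotv_ge0 (enorm y *: x + enorm x *: y).
rewrite !dotvE -!sqr_enorm (dotvC y x) => h.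
rewrite -subr_ge0 opprK -(pmulr_rge0 _ xy0) -(pmulr_rge0 _ (ltr0n _ 2)).
by apply: le_trans h _; rewrite le_eqVlt; apply/orP; left; apply/eqP; ring.
Qed.

(** Expanding the squared distance from [x] to [y] around [p] leaves a cross term of favourable
    sign. Hence [p] is a minimizer, and any minimizer [q] satisfies [dotv (q - p) (q - p) <= 0]. *)
Lemma proj_unique K x p :
  K p -> (forall y, K y -> dotv (x - p) (y - p) <= 0) -> proj K x = p.
Proof.
move=> Kp pP.
have dist y : dotv (x - y) (x - y) =
    dotv (x - p) (x - p) - 2 * dotv (x - p) (y - p) + dotv (y - p) (y - p).
  by rewrite !dotvE !(dotvC y x) !(dotvC p x) !(dotvC p y); ring.
have pmin : argmin_dist K x p.
  split=> // y Ky; apply: ler_wsqrtr.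
  rewrite (dist y); have := pP y Ky; have := dotv_ge0 (y - p); lra.
(* The default value of [xget] is excluded by [pmin], so some minimizer [q] was chosen. *)
rewrite /proj; case: xgetP => [q _ [Kq qmin]|/(_ p)//].
have qp : dotv (q - p) (q - p) <= 0.
  have := qmin p Kp; rewrite -ler_sqr ?nnegrE ?enorm_ge0 // !sqr_enorm dist.
  have := pP q Kq; lra.
apply/eqP; rewrite -subr_eq0; apply/eqP/enorm_eq0/eqP.
by rewrite /enorm sqrtr_eq0.
Qed.

End Euclidean.

Section SecondOrderCone.
Context {R : realType} {m : nat}.
Implicit Types x y : 'cV[R]_(1 + m).

Lemma hdD x y : hd (x + y) = hd x + hd y.
Proof. by rewrite /hd mxE. Qed.

Lemma hdN x : hd (- x) = - hd x.
Proof. by rewrite /hd mxE. Qed.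

Lemma hdZ (a : R) x : hd (a *: x) = a * hd x.
Proof. by rewrite /hd mxE. Qed.

Lemma tlD x y : tl (x + y) = tl x + tl y.
Proof. by rewrite /tl linearD. Qed.

Lemma tlN x : tl (- x) = - tl x.
Proof. by rewrite /tl linearN. Qed.

Lemma tlZ (a : R) x : tl (a *: x) = a *: tl x.
Proof. by rewrite /tl linearZ. Qed.

Lemma dotv_hd_tl x y : dotv x y = hd x * hd y + dotv (tl x) (tl y).
Proof.
rewrite /dotv big_ord_recl; congr (_ + _).
by apply: eq_bigr => i _; rewrite !mxE -!rshift1.
Qed.

(** By Cauchy-Schwarz the tails contribute at least [- (enorm (tl x) * enorm (tl y))], which the
    product of the heads compensates. *)
Lemma soc_self_dual x y : soc x -> soc y -> 0 <= dotv x y.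
Proof.
rewrite /soc /= => Kx Ky; rewrite dotv_hd_tl.
have := dotv_ge_opp (tl x) (tl y).
have := ler_pM (enorm_ge0 _) (enorm_ge0 _) Kx Ky; lra.
Qed.

(** Covers [tl x = 0] and [tl x != 0] at once: later proofs use [c] only through its product with
    [enorm (tl x)], so they need neither a division nor a case split on the tail. *)
Lemma soc_abs_collinear x : exists2 c : R, tl (soc_abs x) = c *: tl x &
  c * enorm (tl x) = 2^-1 * (`|hd x + enorm (tl x)| - `|hd x - enorm (tl x)|).
Proof.
rewrite soc_absE; case: eqVneq => [t0|t0] /=.
  by exists 0; rewrite ?tl_vec ?t0 ?scale0r // enorm0 addr0 subr0 subrr !mulr0.
eexists; first by rewrite tlZ tl_vec !scalerA.
by rewrite -!mulrA mulVf ?mulr1 //; apply: contra t0 => /eqP/enorm_eq0 ->.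
Qed.

Lemma hd_soc_abs x :
  hd (soc_abs x) = 2^-1 * (`|hd x + enorm (tl x)| + `|hd x - enorm (tl x)|).
Proof.
rewrite soc_absE; case: eqVneq => [->|_] /=.
  by rewrite hd_vec enorm0 addr0 subr0; field.
by rewrite hdZ hd_vec [_ + `|_ + _|]addrC.
Qed.

(** With [a = hd x] and [t = enorm (tl x)], membership amounts to [0 <= |u| + u] for the two
    spectral values [u = a + t] and [u = a - t]. *)
Lemma soc_abs_add x : soc (soc_abs x + x).
Proof.
have [c cE ct] := soc_abs_collinear x.
rewrite /soc /= tlD cE -{2}[tl x]scale1r -scalerDl enormZ.
(* The norm of the tail is moved inside the absolute value, to form the product that [ct]
   evaluates. *)
rewrite -(ger0_norm (enorm_ge0 _)) -normrM mulrDl mul1r ct hdD hd_soc_abs.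
have := enorm_ge0 (tl x).
set a := hd x; set t := enorm _ => t0; rewrite ler_norml.
by case: (ger0P (a + t)) => ?; case: (ger0P (a - t)) => ?; apply/andP; split; lra.
Qed.

Lemma soc_abs_sub x : soc (soc_abs x - x).
Proof.
have [c cE ct] := soc_abs_collinear x.
rewrite /soc /= tlD tlN cE -{2}[tl x]scale1r -scalerBl enormZ.
rewrite -(ger0_norm (enorm_ge0 _)) -normrM mulrBl mul1r ct hdD hdN hd_soc_abs.
have := enorm_ge0 (tl x).
set a := hd x; set t := enorm _ => t0; rewrite ler_norml.
by case: (ger0P (a + t)) => ?; case: (ger0P (a - t)) => ?; apply/andP; split; lra.
Qed.

(** Amounts to orthogonality of [soc_abs x + x] and [soc_abs x - x]. Both sides are half the sum of
    the squared spectral values of [x]. *)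
Lemma dotv_soc_abs x : dotv (soc_abs x) (soc_abs x) = dotv x x.
Proof.
have [c cE ct] := soc_abs_collinear x.
rewrite !dotv_vec cE enormZ exprMn real_normK ?num_real // -exprMn ct hd_soc_abs.
set a := hd x; set t := enorm _.
have sq (u : R) : `|u| ^+ 2 = u ^+ 2 by rewrite real_normK ?num_real.
transitivity (2^-1 * (`|a + t| ^+ 2 + `|a - t| ^+ 2)); first by field.
by rewrite !sq; field.
Qed.

Lemma proj_soc_double x : proj soc (x + x) = soc_abs x + x.
Proof.
apply: proj_unique => [|y Ky]; first exact: soc_abs_add.
(* Since [x + x - p = - (soc_abs x - x)], orthogonality reduces the variational inequality to
   [0 <= dotv (soc_abs x - x) y]. *)
have := soc_self_dual (soc_abs_sub x) Ky; have := dotv_soc_abs x.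
by move: (soc_abs x) => z; rewrite !dotvE (dotvC x z); lra.
Qed.

End SecondOrderCone.

Theorem theorem3p1 (R : realType) (m : nat)
    (A : 'M[R]_(1 + m)) (b : 'cV[R]_(1 + m)) :
  (forall xs : 'cV[R]_(1 + m),
     A *m xs - soc_abs xs - b = 0 <-> residual A b xs = 0) /\
  (forall x : 'cV[R]_(1 + m), residual A b x = A *m x - soc_abs x - b).
Proof.
have rE (x : 'cV[R]_(1 + m)) : residual A b x = A *m x - soc_abs x - b.
  rewrite /residual; have -> : Qmap A b x - Fmap A b x = x + x.
    by apply/matrixP => i j; rewrite !mxE; ring.
  by rewrite proj_soc_double; apply/matrixP => i j; rewrite !mxE; ring.
by split=> // xs; rewrite rE.
Qed.
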